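(* The class of circle graphs is contained in the class of ray intersection graphs. Furthermore, every circle graph can be embedded as (i.e. is isomorphic to) the intersection graph of a set of rays in the plane $\mathbb{R}^2$ such that: (i) every ray is grounded on a common curve, i.e. the starting points of all the rays lie on one common curve in the plane; (ii) every ray points towards the upper right quadrant, i.e. its direction vector has positive $x$- and $y$-coordinates (so in particular all rays point into a common half-plane); (iii) every ray is described by a point (its starting point) and a vector (its direction) with polynomial bit complexity, i.e. there is a fixed polynomial $p$ such that for every circle graph with $n$ vertices the coordinates of these points and vectors can be written with at most $p(n)$ bits.
   Context: A circle graph is the intersection graph of a finite set of chords of a circle (one vertex per chord, two distinct vertices adjacent iff the chords intersect); the chords are taken to have pairwise distinct endpoints. A ray is a half-line $\{q+tv : t\ge 0\}$ in $\mathbb{R}^2$ with starting point $q$ and direction vector $v\neq 0$. A ray intersection graph is the intersection graph of a finite set of rays in the plane: one vertex per ray, two distinct vertices adjacent iff the rays intersect. *)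

(* Defs.v *)
From HB Require Import structures.
From mathcomp Require Import all_boot all_order all_algebra.
From mathcomp Require Import all_classical all_reals all_analysis.

Set Implicit Arguments.
Unset Strict Implicit.
Unset Printing Implicit Defensive.

Import Order.TTheory GRing.Theory Num.Theory.
Import numFieldNormedType.Exports.

Local Open Scope classical_set_scope.
Local Open Scope ring_scope.

Record sgraph := SGraph {
  vertex :> finType;
  adj : rel vertex;
  adj_sym : symmetric adj;
  adj_irrefl : irreflexive adj
}.

(* The plane is ['rV[R]_2], with abscissa [p 0 0] and ordinate [p 0 1].  The
   library norm on row vectors is the sup norm, so Euclidean circles are given
   by their equation. *)
Definition circle (R : realType) (c : 'rV[R]_2) (r : R) : set 'rV[R]_2 :=
  [set p | (p 0 0 - c 0 0) ^+ 2 + (p 0 1 - c 0 1) ^+ 2 = r ^+ 2].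

Definition segment (R : realType) (a b : 'rV[R]_2) : set 'rV[R]_2 :=
  [set (1 - t) *: a + t *: b | t in `[0, 1]].

Definition ray (R : realType) (q v : 'rV[R]_2) : set 'rV[R]_2 :=
  [set q + t *: v | t in `[0, +oo[].

(* [G] is isomorphic, through [S], to the intersection graph of the finite set
   of plane sets [range S]; injectivity of [S] is "one vertex per member". *)
Definition intersection_representation (R : realType) (G : sgraph)
    (S : G -> set 'rV[R]_2) : Prop :=
  injective S /\
  forall x y : G, x != y -> (adj x y <-> S x `&` S y !=set0).

(* The last three conditions say that the endpoints of all the chords are
   pairwise distinct; the third one, taken at [x = y], makes every chord
   nondegenerate. *)
Definition circle_graph (R : realType) (G : sgraph) : Prop :=
  exists (c : 'rV[R]_2) (r : R) (a b : G -> 'rV[R]_2),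
    [/\ 0 < r,
        forall x : G, circle c r (a x) /\ circle c r (b x),
        [/\ injective a, injective b & forall x y : G, a x != b y] &
        intersection_representation (fun x => segment (a x) (b x))].

Definition ray_intersection_graph (R : realType) (G : sgraph) : Prop :=
  exists q v : G -> 'rV[R]_2,
    (forall x : G, v x != 0) /\
    intersection_representation (fun x => ray (q x) (v x)).

(* Curves are simple arcs: injectivity rules out space-filling curves, for
   which lying on a common curve would be void. *)
Definition plane_curve (R : realType) (C : set 'rV[R]_2) : Prop :=
  exists gamma : R -> 'rV[R]_2,
    [/\ {within `[0, 1], continuous gamma},
        {in `[0, 1] &, injective gamma} &
        C = gamma @` `[0, 1]].

(* One sign bit and the binary digits of the absolute value ([0] has one). *)
Definition int_bits (z : int) : nat := (1 + (trunc_log 2 `|z|%N).+1)%N.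

Definition rat_bits (x : rat) : nat := (int_bits (numq x) + int_bits (denq x))%N.

Definition point_bits (p : 'rV[rat]_2) : nat :=
  (rat_bits (p 0%R 0%R) + rat_bits (p 0%R 1%R))%N.

Definition rat_point (R : realType) (p : 'rV[rat]_2) : 'rV[R]_2 :=
  map_mx ratr p.

(* Main.v *)
Require Import Defs.
From HB Require Import structures.
From mathcomp Require Import all_boot all_order all_algebra.
From mathcomp Require Import all_classical all_reals all_analysis.
From mathcomp Require Import ring lra zify.

(* Cut the circle at a point that is not an endpoint and number the endpoints
   [0, ..., 2n-1]: two chords cross iff their intervals [(l, h)] interleave.
   Put endpoint [i] at abscissa [2^i] on a concave parabola and represent the
   chord [(l, h)] by the ray from point [l] through point [h].  Interleaved
   intervals give crossing chords of the parabola.  Rays of disjoint intervals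
   do not meet, by concavity.  For nested intervals the inner ray could only
   catch the outer one beyond the parabola, but the chord [(l, h)] has slope
   [M - (2^l + 2^h)], so that the right end decides which slope is larger and
   the inner ray stays above.  The term [M] is a shear that makes all slopes
   positive. *)

Set Implicit Arguments.
Unset Strict Implicit.
Unset Printing Implicit Defensive.

Import Order.TTheory GRing.Theory Num.Theory.
Import numFieldNormedType.Exports.

Local Open Scope classical_set_scope.
Local Open Scope ring_scope.

(** * Vectors with two coordinates *)

Definition row2 (T : Type) (x y : T) : 'rV[T]_2 :=
  \row_(j < 2) if j == 0 then x else y.

Lemma row2E0 (T : Type) (x y : T) : row2 x y 0 0 = x.
Proof. by rewrite mxE. Qed.

Lemma row2E1 (T : Type) (x y : T) : row2 x y 0 1 = y.
Proof. by rewrite mxE. Qed.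

Lemma rV2P (T : Type) (p q : 'rV[T]_2) :
  p 0 0 = q 0 0 -> p 0 1 = q 0 1 -> p = q.
Proof.
move=> e0 e1; apply/rowP => -[[|[|//]] lt_j2].
- by rewrite (_ : Ordinal lt_j2 = 0) //; apply: val_inj.
- by rewrite (_ : Ordinal lt_j2 = 1) //; apply: val_inj.
Qed.

Lemma map_row2 (S T : Type) (f : S -> T) (x y : S) :
  map_mx f (row2 x y) = row2 (f x) (f y).
Proof. by apply: rV2P; rewrite mxE ?row2E0 ?row2E1. Qed.

(** * Crossing of chords in terms of circle parameters *)

Section Chords.
Variable R : realType.
Implicit Types (p a b c d u : 'rV[R]_2) (r s t : R).

(** Twice the signed area of the triangle [p], [a], [b]: the sign gives the side of the line [pa] on
    which [b] lies. *)
Definition orient p a b : R :=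
  (a 0 0 - p 0 0) * (b 0 1 - p 0 1) - (a 0 1 - p 0 1) * (b 0 0 - p 0 0).

Lemma segments_meet a b c d :
  orient a b c * orient a b d < 0 -> orient c d a * orient c d b < 0 ->
  segment a b `&` segment c d !=set0.
Proof.
(* [x / (x - y)] is the zero of the affine function with value [x] at 0 and [y] at 1. *)
have divI (x y : R) : x * y < 0 -> (x - y != 0) && (x / (x - y) \in `[0, 1]).
  move=> xy_lt0; have [x_gt0|x_lt0|x0] := ltrgt0P x;
    last by rewrite x0 mul0r ltxx in xy_lt0.
  - have y_lt0 : y < 0 by rewrite -(pmulr_rlt0 _ x_gt0).
    have xy0 : 0 < x - y by lra.
    by rewrite (gt_eqF xy0) in_itv /= divr_ge0 ?ler_pdivrMr /=; lra.
  - have y_gt0 : 0 < y by rewrite -(nmulr_rlt0 _ x_lt0).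
    have xy0 : x - y < 0 by lra.
    rewrite (lt_eqF xy0) in_itv /= -mulrNN -invrN divr_ge0 ?ler_pdivrMr /=; lra.
move=> /divI/andP[ab_neq0 abI] /divI/andP[cd_neq0 cdI].
exists ((1 - orient a b c / (orient a b c - orient a b d)) *: c
        + (orient a b c / (orient a b c - orient a b d)) *: d); split.
  exists (orient c d a / (orient c d a - orient c d b)); first exact: cdI.
  by apply: rV2P; rewrite !mxE; move: ab_neq0 cd_neq0; rewrite /orient => ? ?;
    field; apply/andP.
by exists (orient a b c / (orient a b c - orient a b d)).
Qed.

(** [orient a b] is affine in its last argument and vanishes on the line [ab], but keeps a strict
    sign along the segment [cd]. *)
Lemma segments_disjoint a b c d :
  0 < orient a b c * orient a b d -> ~ (segment a b `&` segment c d !=set0).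
Proof.
move=> abcd_gt0 [p [[s _ <-] [t /= tI e]]].
have : (1 - t) * orient a b c + t * orient a b d = 0.
  have e0 : ((1 - t) *: c + t *: d) 0 0 = ((1 - s) *: a + s *: b) 0 0 by rewrite e.
  have e1 : ((1 - t) *: c + t *: d) 0 1 = ((1 - s) *: a + s *: b) 0 1 by rewrite e.
  move: e0 e1; rewrite /orient !mxE => e0 e1.
  transitivity ((b 0 0 - a 0 0) * (((1 - t) * c 0 1 + t * d 0 1) - a 0 1)
     - (b 0 1 - a 0 1) * (((1 - t) * c 0 0 + t * d 0 0) - a 0 0)); first by ring.
  by rewrite e0 e1; ring.
move: tI; rewrite in_itv /= => /andP[t_ge0 t_le1].
move: (orient a b c) (orient a b d) abcd_gt0 => x y xy_gt0 e0 {e}.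
have [x_gt0|x_lt0|x0] := ltrgt0P x;
  last by rewrite x0 mul0r ltxx in xy_gt0.
- have y_gt0 : 0 < y by rewrite -(pmulr_rgt0 _ x_gt0).
  nra.
- have y_lt0 : y < 0 by rewrite -(nmulr_rgt0 _ x_lt0).
  nra.
Qed.

(* Inverse of the stereographic projection from the point [c + r *: u]. *)
Definition circle_param c r u t : 'rV[R]_2 :=
  row2 (c 0 0 + r * (((t ^+ 2 - 1) * u 0 0 - 2 * t * u 0 1) / (t ^+ 2 + 1)))
       (c 0 1 + r * (((t ^+ 2 - 1) * u 0 1 + 2 * t * u 0 0) / (t ^+ 2 + 1))).

Lemma sqrD1_gt0 t : 0 < t ^+ 2 + 1.
Proof. by rewrite ltr_wpDl ?sqr_ge0. Qed.

Lemma sqrD1_neq0 t : t ^+ 2 + 1 != 0.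
Proof. by rewrite gt_eqF ?sqrD1_gt0. Qed.

Lemma circle_param_onto c r u p : r != 0 -> u 0 0 ^+ 2 + u 0 1 ^+ 2 = 1 ->
  circle c r p -> p != c + r *: u -> exists t, p = circle_param c r u t.
Proof.
move=> r0 u1 cp pu.
(* [al] and [be] are the coordinates of [(p - c) / r] in the orthonormal frame of [u] and its
   quarter turn; [al = 1] only at the centre of projection. *)
pose al := ((p 0 0 - c 0 0) * u 0 0 + (p 0 1 - c 0 1) * u 0 1) / r.
pose be := ((p 0 1 - c 0 1) * u 0 0 - (p 0 0 - c 0 0) * u 0 1) / r.
have p0 : p 0 0 = c 0 0 + r * (al * u 0 0 - be * u 0 1).
  transitivity (c 0 0 + (p 0 0 - c 0 0) * (u 0 0 ^+ 2 + u 0 1 ^+ 2));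
    first by rewrite u1; ring.
  by rewrite /al /be; field.
have p1 : p 0 1 = c 0 1 + r * (al * u 0 1 + be * u 0 0).
  transitivity (c 0 1 + (p 0 1 - c 0 1) * (u 0 0 ^+ 2 + u 0 1 ^+ 2));
    first by rewrite u1; ring.
  by rewrite /al /be; field.
have albe : al ^+ 2 + be ^+ 2 = 1.
  transitivity (((p 0 0 - c 0 0) ^+ 2 + (p 0 1 - c 0 1) ^+ 2)
                * (u 0 0 ^+ 2 + u 0 1 ^+ 2) / r ^+ 2).
    by rewrite /al /be; field.
  by rewrite cp u1; field.
have al1 : 1 - al != 0.
  apply: contra pu; rewrite subr_eq0 => /eqP al1.
  have be0 : be = 0.
    by apply/eqP; rewrite -sqrf_eq0; apply/eqP; move: albe; rewrite -al1; lra.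
  by apply/eqP/rV2P; rewrite !mxE ?p0 ?p1 -al1 be0; ring.
exists (be / (1 - al)).
have D0 : (be / (1 - al)) ^+ 2 + 1 = 2 / (1 - al).
  transitivity ((al ^+ 2 + be ^+ 2 + 1 - 2 * al) / (1 - al) ^+ 2);
    first by field.
  by rewrite albe; field.
have D1 : (be / (1 - al)) ^+ 2 - 1 = 2 * al / (1 - al).
  transitivity (((al ^+ 2 + be ^+ 2) - 1 - 2 * al ^+ 2 + 2 * al)
                / (1 - al) ^+ 2); first by field.
  by rewrite albe; field.
by rewrite /circle_param D0 D1; apply: rV2P; rewrite ?row2E0 ?row2E1 ?p0 ?p1;
  congr (_ + _ * _); field.
Qed.

Lemma orient_circle_param c r u t1 t2 t3 : u 0 0 ^+ 2 + u 0 1 ^+ 2 = 1 ->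
  orient (circle_param c r u t1) (circle_param c r u t2) (circle_param c r u t3) =
  - 4 * r ^+ 2 * (t2 - t1) * (t3 - t1) * (t3 - t2)
    / ((t1 ^+ 2 + 1) * (t2 ^+ 2 + 1) * (t3 ^+ 2 + 1)).
Proof.
(* Writing the factor 1 as the squared length of [u] makes both sides quadratic in [u], hence a
   field identity. *)
move=> u1; rewrite -[RHS]mul1r -{1}u1 /orient /circle_param !row2E0 !row2E1.
by field; rewrite !sqrD1_neq0.
Qed.

(** [(z - s) * (z - t)] is negative exactly between [s] and [t], so this says that one of [s'], [t']
    is between them and the other beyond. The ends of each chord need not be ordered. *)
Definition interleaved (s t s' t' : R) : bool :=
  (s' - s) * (s' - t) * ((t' - s) * (t' - t)) < 0.

Lemma chords_meet c r u s t s' t' :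
  r != 0 -> u 0 0 ^+ 2 + u 0 1 ^+ 2 = 1 ->
  s != t -> s' != t' -> s != s' -> s != t' -> t != s' -> t != t' ->
  segment (circle_param c r u s) (circle_param c r u t)
    `&` segment (circle_param c r u s') (circle_param c r u t') !=set0
  <-> interleaved s t s' t'.
Proof.
move=> r0 u1 st st' ss' s_t' ts' tt'.
pose P := circle_param c r u.
(* The factor [y - x] occurs in both orientations, so it enters the product squared and leaves the
   sign alone. *)
have E (x y z w : R) : x != y -> exists2 k, 0 < k &
    orient (P x) (P y) (P z) * orient (P x) (P y) (P w)
    = k * ((z - x) * (z - y) * ((w - x) * (w - y))).
  move=> xy; exists ((4 * r ^+ 2 * (y - x) / ((x ^+ 2 + 1) * (y ^+ 2 + 1))) ^+ 2
      / ((z ^+ 2 + 1) * (w ^+ 2 + 1))).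
    apply: divr_gt0; last by rewrite mulr_gt0 ?sqrD1_gt0.
    rewrite exprn_even_gt0 //= !mulf_neq0 ?invr_eq0 ?mulf_neq0 ?sqrD1_neq0 //.
    by rewrite subr_eq0 eq_sym.
  by rewrite /P !orient_circle_param //; field; rewrite !sqrD1_neq0.
have [k k_gt0 ek] := E s t s' t' st.
have [l l_gt0 el] := E s' t' s t st'.
split.
  apply: contraPT; rewrite /interleaved -leNgt le_eqVlt => /orP[|H].
    by rewrite eq_sym !mulf_eq0 !subr_eq0 ![s' == _]eq_sym ![t' == _]eq_sym
      (negPf ss') (negPf s_t') (negPf ts') (negPf tt').
  by apply: segments_disjoint; rewrite ek mulr_gt0.
move=> H; apply: segments_meet; rewrite ?ek ?el pmulr_rlt0 //.
by rewrite /interleaved in H; nra.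
Qed.

End Chords.

(** * Cutting the circle away from the endpoints *)

Lemma injective_notin (T : eqType) (g : nat -> T) (s : seq T) :
  injective g -> exists k, g k \notin s.
Proof.
move=> g_inj; apply: contrapT => no_k.
have /(uniq_leq_size _) : {subset map g (iota 0 (size s).+1) <= s}.
  move=> _ /mapP[k _ ->]; apply: contrapT => /negP ks.
  by apply: no_k; exists k.
by rewrite map_inj_uniq // iota_uniq size_map size_iota ltnn => /(_ isT).
Qed.

Lemma circle_avoid (R : realType) (c : 'rV[R]_2) (r : R) (s : seq 'rV[R]_2) :
  r != 0 ->
  exists2 u : 'rV[R]_2, u 0 0 ^+ 2 + u 0 1 ^+ 2 = 1 & c + r *: u \notin s.
Proof.
move=> r0.
(* Infinitely many unit vectors, told apart by the abscissa [1 - 2 / (k ^ 2 + 1)]. *)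
pose u (k : nat) : 'rV[R]_2 := circle_param 0 1 (row2 1 0) k%:R.
have u0 k : u k 0 0 = 1 - 2 / (k%:R ^+ 2 + 1).
  by rewrite /u /circle_param !row2E0 row2E1 !mxE; field; rewrite sqrD1_neq0.
have u1 k : u k 0 1 = 2 * k%:R / (k%:R ^+ 2 + 1).
  by rewrite /u /circle_param !row2E0 !row2E1 !mxE; field; rewrite sqrD1_neq0.
have two0 : (2 : R) != 0 by rewrite pnatr_eq0.
have u_inj : injective (fun k => c + r *: u k).
  move=> i j /addrI/(scalerI r0) /(congr1 (fun p : 'rV_2 => p 0 0)).
  rewrite !u0 => /addrI/oppr_inj/(mulfI two0).
  move=> /invr_inj/addIr/eqP; by rewrite eqrXn2 // eqr_nat => /eqP.
have [k ks] := injective_notin s u_inj.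
by exists (u k) => //; rewrite u0 u1; field; rewrite sqrD1_neq0.
Qed.

Lemma circle_graph_interleaved (R : realType) (G : sgraph) :
  circle_graph R G -> exists s t : G -> R,
    [/\ injective s, injective t, forall x y, s x != t y &
        forall x y, x != y -> (adj x y <-> interleaved (s x) (t x) (s y) (t y))].
Proof.
move=> [c [r [a [b [r_gt0 abC [a_inj b_inj ab] [_ adjE]]]]]].
have r0 : r != 0 by rewrite gt_eqF.
have [u u1] := circle_avoid c (map a (enum G) ++ map b (enum G)) r0.
rewrite mem_cat negb_or => /andP[ua ub].
have /choice[s aE] : forall x, exists t, a x = circle_param c r u t.
  move=> x; apply: circle_param_onto => //; first by case: (abC x).
  by apply: contraNneq ua => <-; rewrite map_f ?mem_enum.
have /choice[t bE] : forall x, exists t, b x = circle_param c r u t.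
  move=> x; apply: circle_param_onto => //; first by case: (abC x).
  by apply: contraNneq ub => <-; rewrite map_f ?mem_enum.
have s_inj : injective s by move=> x y e; apply: a_inj; rewrite !aE e.
have t_inj : injective t by move=> x y e; apply: b_inj; rewrite !bE e.
have st x y : s x != t y by apply: contra (ab x y) => /eqP e; rewrite aE bE e.
exists s, t; split=> // x y xy; rewrite adjE // !aE !bE.
by apply: chords_meet; rewrite ?(inj_eq s_inj) ?(inj_eq t_inj) // eq_sym.
Qed.

(** * Numbering the endpoints by integers *)

Definition rank (d : Order.disp_t) (R : orderType d) (T : finType) (f : T -> R)
  (z : T) : nat := #|[pred w | (f w < f z)%O]|.

Lemma ltn_rank (d : Order.disp_t) (R : orderType d) (T : finType) (f : T -> R)
  (z w : T) : (rank f z < rank f w)%N = (f z < f w)%O.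
Proof.
case: ltP => [zw|wz]; last first.
  rewrite ltnNge subset_leq_card //; apply/fintype.subsetP => v; rewrite !inE.
  by move/lt_le_trans; apply.
apply: proper_card; apply/properP; split; last by exists z; rewrite !inE ?ltxx.
by apply/fintype.subsetP => v; rewrite !inE => /lt_trans; apply.
Qed.

Lemma rank_lt_card (d : Order.disp_t) (R : orderType d) (T : finType)
  (f : T -> R) (z : T) : (rank f z < #|T|)%N.
Proof.
apply: proper_card; apply/properP; split; last by exists z; rewrite !inE ?ltxx.
exact/fintype.subsetP.
Qed.

Lemma interleavedP (R : realType) (s t s' t' : R) : s < t -> s' < t' ->
  interleaved s t s' t' = (s < s' < t) && (t < t') || (s' < s < t') && (t' < t).
Proof.
move=> st st'; rewrite /interleaved !mulr_lt0 !mulf_eq0 !subr_eq0 !subr_lt0.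
by case: (ltgtP s' s); case: (ltgtP s' t); case: (ltgtP t' s); case: (ltgtP t' t);
  move=> * //=; lra.
Qed.

Lemma circle_graph_intervals (R : realType) (G : sgraph) :
  circle_graph R G -> exists l h : G -> nat,
    [/\ injective l, injective h, forall x y, l x != h y,
        forall x, (l x < h x < 2 * #|G|)%N &
        forall x y, x != y -> (adj x y <->
          ((l x < l y < h x) && (h x < h y)
          || (l y < l x < h y) && (h y < h x))%N)].
Proof.
move=> /circle_graph_interleaved[s [t [s_inj t_inj st adjE]]].
(* All endpoints at once, indexed by [G + G]: lower ends on the left, upper ends on the right. Ranks
   are therefore below [2 * #|G|]. *)
pose f z := match z with
            | inl x => Num.min (s x) (t x)
            | inr x => Num.max (s x) (t x)
            end.
have st_lt x : f (inl x) < f (inr x).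
  by rewrite /f; move: (st x x); case: (ltgtP (s x) (t x)).
have f_inj : injective f.
  have ts x y : t x != s y by rewrite eq_sym.
  move=> [x|x] [y|y]; rewrite /f /Num.min /Num.max;
    (case: ifP => hx; case: ifP => hy) => /eqP;
    rewrite ?(inj_eq s_inj) ?(inj_eq t_inj) ?(negPf (st _ _)) ?(negPf (ts _ _)) //;
    move=> /eqP e; subst; congruence.
have rank_inj : injective (rank f).
  by move=> z w e; apply: f_inj; apply/eqP; rewrite eq_le !leNgt -!ltn_rank e ltnn.
exists (fun x => rank f (inl x)), (fun x => rank f (inr x)); split.
- by move=> x y /rank_inj[].
- by move=> x y /rank_inj[].
- by move=> x y; apply/eqP => /rank_inj.
- move=> x; rewrite ltn_rank st_lt /=.
  by rewrite mul2n -addnn -card_sum rank_lt_card.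
- move=> x y xy; rewrite adjE //.
  suff -> : interleaved (s x) (t x) (s y) (t y) =
      interleaved (f (inl x)) (f (inr x)) (f (inl y)) (f (inr y)).
    by rewrite interleavedP // !ltn_rank.
  (* Exchanging the two ends of a chord does not change the product. *)
  by rewrite /interleaved /f; congr (_ < 0); rewrite /Num.min /Num.max;
    case: ifP => _; case: ifP => _; ring.
Qed.

(** * Rays along chords of a concave parabola *)

Section Parabola.
Variable R : realType.
Implicit Types M A B C D X : R.

Definition parabola_pt M A : 'rV[R]_2 := row2 A (M * A - A ^+ 2).

(* Direction of the chord of the parabola with end abscissas [A] and [B]. *)
Definition parabola_dir M A B : 'rV[R]_2 := row2 1 (M - (A + B)).

Lemma parabola_rayE M A B (p : 'rV[R]_2) :
  ray (parabola_pt M A) (parabola_dir M A B) p <->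
  A <= p 0 0 /\ p 0 1 = (M - (A + B)) * p 0 0 + A * B.
Proof.
split=> [[t /= tI <-]|[Ap pE]].
  move: tI; rewrite in_itv /= andbT => t_ge0.
  rewrite !mxE /=; split; first by rewrite mulr1 lerDl.
  by ring.
exists (p 0 0 - A); first by rewrite /= in_itv /= andbT subr_ge0.
by apply: rV2P; rewrite !mxE /= ?pE; ring.
Qed.

(** The abscissa of the starting point is the least one on the ray. *)
Lemma parabola_ray_inj M A B C D :
  ray (parabola_pt M A) (parabola_dir M A B) =
  ray (parabola_pt M C) (parabola_dir M C D) -> A = C.
Proof.
have start A' B' C' D' : ray (parabola_pt M A') (parabola_dir M A' B') =
    ray (parabola_pt M C') (parabola_dir M C' D') -> C' <= A'.
  move=> e; have : ray (parabola_pt M A') (parabola_dir M A' B') (parabola_pt M A').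
    by apply/parabola_rayE; rewrite row2E0 row2E1; split=> //; ring.
  by rewrite e => /parabola_rayE[]; rewrite row2E0.
move=> e; apply/eqP; rewrite eq_le (start _ _ _ _ e).
by rewrite (start _ _ _ _ (esym e)).
Qed.

Lemma parabola_rays_meet M A B C D :
  A < B -> C < D -> A < C -> C != B -> B != D -> (D < B -> C + D < A + B) ->
  ray (parabola_pt M A) (parabola_dir M A B)
    `&` ray (parabola_pt M C) (parabola_dir M C D) !=set0 <->
  (C < B) && (B < D).
Proof.
move=> AB CD AC CB BD slope; split.
  move=> [p [/parabola_rayE[Ap pE] /parabola_rayE[Cp]]]; rewrite {}pE.
  move: (p 0 0) Ap Cp => X AX CX e.
  (* Both lines have equal height at [X >= C]. If [B < C], the left side is nonnegative and the
     right side negative; if [D < B], then [C < B] makes the right side positive while [slope] makes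
     the left side at most 0. *)
  have {}e : (C + D - (A + B)) * (X - C) = - ((C - A) * (C - B)).
    by lra.
  have [CltB|BltC|CeB] := ltgtP C B; last by rewrite CeB eqxx in CB.
    have [//|DltB|BeD] := ltgtP B D; last by rewrite BeD eqxx in BD.
    have := slope DltB; nra.
  nra.
move=> /andP[CltB BltD].
have k_gt0 : 0 < C + D - (A + B) by lra.
(* The abscissa at which the two lines cross. *)
pose X := (C * D - A * B) / (C + D - (A + B)).
have XE : (C + D - (A + B)) * X = C * D - A * B.
  by rewrite /X; field; rewrite gt_eqF.
have CX : C <= X by rewrite /X ler_pdivlMr //; nra.
exists (row2 X ((M - (A + B)) * X + A * B)); split; apply/parabola_rayE;
  rewrite row2E0 row2E1; split=> //; lra.
Qed.

Definition parabola_arc M K : set 'rV[R]_2 :=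
  (fun s => parabola_pt M (K * s)) @` `[0, 1].

Lemma parabola_arcP M K A : 0 < K -> 0 <= A -> A <= K ->
  parabola_arc M K (parabola_pt M A).
Proof.
move=> K_gt0 A_ge0 AK; exists (A / K).
  by rewrite /= in_itv /= divr_ge0 ?ler_pdivrMr ?mul1r // ltW.
by rewrite mulrC divfK // gt_eqF.
Qed.

Lemma parabola_arc_curve M K : 0 < K -> plane_curve (parabola_arc M K).
Proof.
move=> K_gt0; exists (fun s => parabola_pt M (K * s)); split=> //.
  apply: continuous_subspaceT.
  (* Splitting off fixed vectors reduces continuity to that of [s] and [s * s]. *)
  rewrite (_ : (fun s => _) =
    (fun s : R => s *: row2 K (M * K) + (s * s) *: row2 0 (- K ^+ 2))).
    move=> s; apply: cvgD; apply: cvgZr_tmp => //.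
    by apply: cvgM.
  by apply/funext => s; apply: rV2P; rewrite !mxE /=; ring.
move=> s t _ _ /(congr1 (fun p : 'rV_2 => p 0 0)); rewrite !row2E0.
by apply: mulfI; rewrite gt_eqF.
Qed.

End Parabola.

(** * Bit sizes and powers of two *)

Lemma int_bits_nat (k N : nat) : (k <= 2 ^ N)%N -> (int_bits k <= N + 2)%N.
Proof.
move=> kN; rewrite /int_bits absz_nat.
have : (trunc_log 2 k <= trunc_log 2 (2 ^ N))%N by apply: leq_trunc_log.
by rewrite trunc_expnK //; lia.
Qed.

(** The denominators are 1 and take at most two bits, so a coordinate takes at most [N + 4]. *)
Lemma point_bits_nat (k l N : nat) : (k <= 2 ^ N)%N -> (l <= 2 ^ N)%N ->
  (point_bits (row2 k%:R l%:R) <= 2 * (N + 4))%N.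
Proof.
move=> kN lN; rewrite /point_bits row2E0 row2E1 /rat_bits.
rewrite !pmulrn !numq_int !denq_int.
have := int_bits_nat kN; have := int_bits_nat lN.
have : (int_bits 1 <= 0 + 2)%N by apply: int_bits_nat.
lia.
Qed.

Lemma exp2D_lt (i j k : nat) : (i < j)%N -> (j < k)%N ->
  (2 ^ i + 2 ^ j < 2 ^ k)%N.
Proof.
move=> ij jk; apply: (@leq_trans (2 ^ j.+1)); last by rewrite leq_exp2l.
by rewrite expnS mul2n -addnn ltn_add2r ltn_exp2l.
Qed.

(** * Assembling the rays *)

Lemma circle_graph_grounded_rays (R : realType) (G : sgraph) :
  circle_graph R G ->
  exists q v : G -> 'rV[R]_2,
    [/\ intersection_representation (fun x => ray (q x) (v x)),
        exists C : set 'rV[R]_2, plane_curve C /\ forall x : G, C (q x),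
        forall x : G, 0 < v x 0 0 /\ 0 < v x 0 1 &
        exists q' v' : G -> 'rV[rat]_2,
          [/\ forall x : G, q x = rat_point R (q' x),
              forall x : G, v x = rat_point R (v' x) &
              (\sum_(x : G) (point_bits (q' x) + point_bits (v' x))
                 <= 16 * #|G| ^ 2 + 16 * #|G|)%N]].
Proof.
move=> /circle_graph_intervals[l [h [l_inj h_inj lh lh_lt adjE]]].
(* [M] exceeds every [2 ^ l x + 2 ^ h x], so all slopes are positive; it also serves as the width of
   the arc carrying the starting points. *)
pose N := (2 * #|G|)%N; pose M := (2 ^ N)%N.
have l_lt x : (l x < h x)%N by case/andP: (lh_lt x).
have h_lt x : (h x < N)%N by case/andP: (lh_lt x).
have l_ltN x : (l x < N)%N by apply: ltn_trans (h_lt x).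
have sumM x : (2 ^ l x + 2 ^ h x < M)%N by apply: exp2D_lt.
pose a x : R := (2 ^ l x)%:R; pose b x : R := (2 ^ h x)%:R.
have meet x y : (l x < l y)%N ->
    ray (parabola_pt M%:R (a x)) (parabola_dir M%:R (a x) (b x))
      `&` ray (parabola_pt M%:R (a y)) (parabola_dir M%:R (a y) (b y)) !=set0
    <-> (l y < h x)%N && (h x < h y)%N.
  move=> lxy; have hxy : h x != h y.
    by apply: contraTneq lxy => /h_inj ->; rewrite ltnn.
  rewrite parabola_rays_meet /a /b ?ltr_nat ?eqr_nat ?eqn_exp2l ?ltn_exp2l //.
  (* For nested intervals [2 ^ h x] alone outweighs both powers of the inner interval [y]. *)
  move=> hyx; rewrite -!natrD ltr_nat.
  exact: leq_trans (exp2D_lt (l_lt y) hyx) (leq_addl _ _).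
exists (fun x => parabola_pt M%:R (a x)), (fun x => parabola_dir M%:R (a x) (b x)).
split.
- split.
    move=> x y /parabola_ray_inj/eqP.
    by rewrite eqr_nat eqn_exp2l // => /eqP/l_inj.
  move=> x y xy; rewrite adjE //.
  case: (ltngtP (l x) (l y)) => [lxy|lyx|/l_inj exy]; last by rewrite exy eqxx in xy.
    by rewrite meet //= orbF.
  by rewrite setIC meet.
- exists (parabola_arc M%:R M%:R); split.
    by apply: parabola_arc_curve; rewrite ltr0n expn_gt0.
  move=> x; apply: parabola_arcP; rewrite ?ler0n ?ltr0n ?expn_gt0 //.
  by rewrite ler_nat leq_exp2l // ltnW.
- by move=> x; rewrite row2E0 row2E1 ltr01 subr_gt0 -natrD ltr_nat.
(* The subtractions in [nat] are exact, since [2 ^ l x <= M] and [2 ^ l x + 2 ^ h x < M]. *)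
exists (fun x => row2 (2 ^ l x)%:R (M * 2 ^ l x - 2 ^ l x * 2 ^ l x)%:R),
  (fun x => row2 1%:R (M - (2 ^ l x + 2 ^ h x))%:R); split.
- move=> x; rewrite /rat_point map_row2 !ratr_nat natrB ?natrM ?[_%:R ^+ 2]expr2 //.
  by rewrite leq_mul2r leq_exp2l // (ltnW (l_ltN x)) orbT.
- move=> x; rewrite /rat_point map_row2 !ratr_nat /parabola_dir natrB ?natrD //.
  exact: ltnW.
(* All coordinates are at most [M * M = 2 ^ (2 * N)], so the starting point and the direction cost
   at most [2 * (2 * N + 4) = 8 * #|G| + 8] bits each. *)
apply: (@leq_trans (\sum_(x : G) (16 * #|G| + 16))); last first.
  by rewrite sum_nat_const mulnDr mulnCA mulnn [(_ * 16)%N]mulnC.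
apply: leq_sum => x _.
have MM : (M * M = 2 ^ (2 * N))%N by rewrite mul2n -addnn expnD.
have le_M : (M <= 2 ^ (2 * N))%N by rewrite leq_exp2l // leq_pmull.
have lM : (2 ^ l x <= M)%N by rewrite leq_exp2l // ltnW.
have := @point_bits_nat (2 ^ l x) (M * 2 ^ l x - 2 ^ l x * 2 ^ l x) (2 * N).
have := @point_bits_nat 1 (M - (2 ^ l x + 2 ^ h x)) (2 * N).
rewrite (leq_trans lM) // (leq_trans (leq_subr _ _) le_M) expn_gt0.
rewrite (leq_trans (leq_subr _ _)) ?MM -?MM ?leq_mul2l ?lM ?orbT //.
move=> /(_ isT isT) ? /(_ isT isT) ?; rewrite /N in MM *; lia.
Qed.

Theorem theorem1 (R : realType) :
  (forall G : sgraph, circle_graph R G -> ray_intersection_graph R G) /\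
  (exists p : {poly nat},
    forall G : sgraph, circle_graph R G ->
      exists q v : G -> 'rV[R]_2,
        [/\ intersection_representation (fun x => ray (q x) (v x)),
            exists C : set 'rV[R]_2, plane_curve C /\ forall x : G, C (q x),
            forall x : G, 0 < v x 0 0 /\ 0 < v x 0 1 &
            exists q' v' : G -> 'rV[rat]_2,
              [/\ forall x : G, q x = rat_point R (q' x),
                  forall x : G, v x = rat_point R (v' x) &
                  (\sum_(x : G) (point_bits (q' x) + point_bits (v' x))
                     <= p.[#|G|])%N]]).
Proof.
split=> [G /circle_graph_grounded_rays[q [v [repr _ v_gt0 _]]]|].
  exists q, v; split=> // x; apply/eqP => v0.
  by have [] := v_gt0 x; rewrite v0 mxE ltxx.
exists (16%:P * 'X^2 + 16%:P * 'X) => G circG.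
have -> : (16%:P * 'X^2 + 16%:P * 'X : {poly nat}).[#|G|] =
    (16 * #|G| ^ 2 + 16 * #|G|)%N.
  by rewrite !hornerE.
exact: circle_graph_grounded_rays circG.
Qed.
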